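(* Let $K$ be a field, $G$ a finite group, and $M,N$ finite-dimensional $KG$-modules. Then $\ell(M\otimes N)$ is the maximum of $\ell(A\otimes B)$, where $A$ and $B$ range over the subquotients of $M$ and $N$ respectively that have simple top and simple socle.
   Context: The tensor product of $KG$-modules is over $K$ with diagonal action $g(m\otimes n)=gm\otimes gn$. $\ell(M)$ denotes the Loewy length of $M$, $\ell(M)=\min\{n\in\mathbb{N}\mid \mathrm{rad}^n(KG)M=0\}$. A subquotient of $M$ is a quotient of a submodule of $M$. The top of $M$ is $M/\mathrm{rad}\,M$, and the socle of $M$ is its maximal semisimple submodule. The maximum over an empty set (occurring only if $M=0$ or $N=0$) is read as $0$. *)

(* Defs.v *)
From mathcomp Require Import all_boot all_order all_algebra all_fingroup.
From mathcomp Require Import mxrepresentation character.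
From mathcomp Require Import boolp.

Set Implicit Arguments.
Unset Strict Implicit.
Unset Printing Implicit Defensive.

Import GroupScope GRing.Theory.
Local Open Scope ring_scope.

(* A finite-dimensional KG-module is an [mx_representation K G n], acting on
   the row space 'rV_n by right multiplication.  A left module corresponds to
   the right module with m g := g^-1 m; this changes neither submodules,
   quotients nor diagonal tensor products ([prod_repr]).  The group algebra KG
   is the regular module, with underlying space 'rV_#|G|; [gring_mx rG x] is
   the operator by which x in KG acts on the module rG. *)

Section IntersectionOfSubspaces.
Variables (K : fieldType) (n : nat).

Lemma bigcap_mx_exists (P : 'M[K]_n -> Prop) :
  exists C : 'M[K]_n,
    forall v : 'rV[K]_n, (v <= C)%MS <-> forall U, P U -> (v <= U)%MS.
Proof.
pose Q (C : 'M[K]_n) := forall v : 'rV[K]_n,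
  (forall U, P U -> (v <= U)%MS) -> (v <= C)%MS.
have exQ : exists r, `[< exists C, Q C /\ \rank C = r >].
  exists (\rank (1%:M : 'M[K]_n)); apply/asboolP; exists 1%:M; split=> // v _.
  exact: submx1.
case: (ex_minnP exQ) => r /asboolP[C [QC rC]] minr.
exists C => v; split; last exact: QC.
move=> vC U PU; apply: submx_trans vC _.
have QCU : Q (C :&: U)%MS by move=> w hw; rewrite sub_capmx QC // hw.
have /minr : `[< exists D, Q D /\ \rank D = \rank (C :&: U)%MS >].
  by apply/asboolP; exists (C :&: U)%MS.
rewrite -rC => le_r; apply: submx_trans (capmxSr C U).
by rewrite -(mxrank_leqif_sup (capmxSl C U)) eqn_leq le_r mxrankS ?capmxSl.
Qed.

(* The intersection of all U such that P U (the whole space if there is none). *)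
Definition bigcap_mx (P : 'M[K]_n -> Prop) : 'M[K]_n :=
  sval (cid (bigcap_mx_exists P)).

Lemma bigcap_mxP (P : 'M[K]_n -> Prop) (v : 'rV[K]_n) :
  (v <= bigcap_mx P)%MS <-> forall U, P U -> (v <= U)%MS.
Proof. by rewrite /bigcap_mx; case: cid. Qed.

End IntersectionOfSubspaces.

Section Modules.
Variables (K : fieldType) (gT : finGroupType) (G : {group gT}).

Section OneModule.
Variables (n : nat) (rG : mx_representation K G n).

Definition maximal_submodule (U : 'M[K]_n) : Prop :=
  mxmodule rG U /\ max_submod rG U 1%:M.

Definition rad : 'M[K]_n := bigcap_mx maximal_submodule.

Lemma rad_module : mxmodule rG rad.
Proof.
apply/mxmoduleP => x Gx; apply/row_subP => i; rewrite row_mul.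
apply/bigcap_mxP => U mU; apply: (mxmodule_trans mU.1 Gx).
exact: (bigcap_mxP _ _).1 (row_sub i rad) U mU.
Qed.

Definition top_repr : mx_representation K G _ := factmod_repr rad_module.

Lemma socleType_inhabited : inhabited (socleType rG).
Proof.
apply/asboolP; apply: (@socle_exists _ _ _ _ rG) => sG; apply/asboolP.
exact: inhabits sG.
Qed.

Definition soc : 'M[K]_n :=
  Socle (inhabited_witness socleType_inhabited).

Lemma soc_semisimple : mxsemisimple rG soc.
Proof. exact: Socle_semisimple. Qed.

Lemma semisimple_sub_soc (U : 'M[K]_n) : mxsemisimple rG U -> (U <= soc)%MS.
Proof. exact: semisimple_Socle. Qed.

Definition simple_top : Prop := mx_irreducible top_repr.
Definition simple_socle : Prop := mxsimple rG soc.

(* For a subspace U and a subspace I of KG, the span of all u x with u in U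
   and x in I. *)
Definition act_mx (U : 'M[K]_n) (I : 'M[K]_#|G|) : 'M[K]_n :=
  (\sum_(i < #|G|) U *m gring_mx rG (row i I))%MS.

Lemma act_mx_subP (U : 'M[K]_n) (I : 'M[K]_#|G|) (W : 'M[K]_n) :
  (act_mx U I <= W)%MS <->
  forall (u : 'rV_n) (x : 'rV_#|G|), (u <= U)%MS -> (x <= I)%MS ->
    (u *m gring_mx rG x <= W)%MS.
Proof.
split=> [/sumsmx_subP h u x uU /submxP[a ->] | h].
  rewrite [a *m _]mulmx_sum_row linear_sum mulmx_sumr summx_sub // => i _.
  rewrite linearZ /= -scalemxAr scalemx_sub //.
  exact: submx_trans (submxMr _ uU) (h i isT).
apply/sumsmx_subP => i _; apply/row_subP => j; rewrite row_mul.
by apply: h; apply: row_sub.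
Qed.

Lemma mem_act_mx (U : 'M[K]_n) (I : 'M[K]_#|G|) (u : 'rV_n) (x : 'rV_#|G|) :
  (u <= U)%MS -> (x <= I)%MS -> (u *m gring_mx rG x <= act_mx U I)%MS.
Proof. by apply: (act_mx_subP U I _).1. Qed.

End OneModule.

Local Notation KG := (regular_repr K G).

(* [rad KG] is the Jacobson radical of KG, the intersection of its maximal
   right ideals; [rad_pow k] is its k-th power, rad_pow 0 being KG itself. *)
Definition rad_pow (k : nat) : 'M[K]_#|G| :=
  iter k (fun I => act_mx KG I (rad KG)) 1%:M.

Section Nilpotency.
Variables (n : nat) (rG : mx_representation K G n).

Lemma gring_mx1 : gring_mx rG (gring_row 1%:M) = 1%:M.
Proof. by rewrite -gring_opE gring_op1. Qed.

Lemma act_mx_sub (W : 'M[K]_n) (I : 'M[K]_#|G|) :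
  mxmodule rG W -> (act_mx rG W I <= W)%MS.
Proof.
move=> mW; apply/act_mx_subP => u x uW _.
by apply: mxmodule_envelop mW _ uW; apply: gring_mxP.
Qed.

Lemma act_mx_module (W : 'M[K]_n) (I : 'M[K]_#|G|) :
  mxmodule KG I -> mxmodule rG (act_mx rG W I).
Proof.
move=> mI; apply/mxmoduleP => g Gg; rewrite /act_mx sumsmxMr.
apply/sumsmx_subP => i _; apply/row_subP => j.
rewrite !row_mul -mulmxA -gring_mxJ //.
apply: mem_act_mx; first exact: row_sub.
exact: (mxmodule_trans mI Gg (row_sub i I)).
Qed.

Lemma max_submod_exists (W : 'M[K]_n) : W != 0 ->
  exists U, mxmodule rG U /\ max_submod rG U W.
Proof.
move=> nzW.
have exQ : exists r, `[< exists U : 'M_n,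
    [/\ mxmodule rG U, (U < W)%MS & \rank U = r] >].
  exists 0%N; apply/asboolP; exists 0; split; rewrite ?mxrank0 //.
    exact: mxmodule0.
  by rewrite lt0mx.
have bQ r : `[< exists U : 'M_n,
    [/\ mxmodule rG U, (U < W)%MS & \rank U = r] >] -> (r <= n)%N.
  by move=> /asboolP[U [_ _ <-]]; apply: rank_leq_row.
case: (ex_maxnP exQ bQ) => r /asboolP[U [mU UW rU]] maxr.
exists U; split=> //; split=> // V [mV UV VW].
have /maxr : `[< exists U0 : 'M_n,
    [/\ mxmodule rG U0, (U0 < W)%MS & \rank U0 = \rank V] >].
  by apply/asboolP; exists V.
by rewrite -rU leqNgt rank_ltmx.
Qed.

Lemma rad_act_max (W U : 'M[K]_n) :
  mxmodule rG W -> mxmodule rG U -> max_submod rG U W ->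
  (act_mx rG W (rad KG) <= U)%MS.
Proof.
move=> mW mU [ltUW maxU]; apply/act_mx_subP => v x vW xJ.
have [vU | vU] := boolP (v <= U)%MS.
  by apply: mxmodule_envelop mU _ vU; apply: gring_mxP.
pose f := lin1_mx (mulmx v \o gring_mx rG).
have fE y : y *m f = v *m gring_mx rG y by rewrite mul_rV_lin1.
pose Kv := kermx (f *m cokermx U).
have KvP (y : 'rV_#|G|) : (y <= Kv)%MS = (v *m gring_mx rG y <= U)%MS.
  by rewrite sub_kermx mulmxA fE -submxE.
suff mKv : maximal_submodule KG Kv.
  by rewrite -KvP; apply: (bigcap_mxP _ _).1 xJ _ mKv.
pose e := gring_row (1%:M : 'M[K]_#|G|).
have fe : e *m f = v by rewrite fE gring_mx1 mulmx1.
split.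
  apply/mxmoduleP => g Gg; apply/row_subP => i; rewrite row_mul KvP.
  rewrite gring_mxJ // mulmxA; apply: (mxmodule_trans mU Gg).
  by rewrite -KvP row_sub.
split.
  rewrite ltmxE submx1 /=; apply/negP => /(submx_trans (submx1 e)).
  by rewrite KvP gring_mx1 mulmx1 (negPf vU).
move=> I [mI ltKI ltI1].
have mIf : mxmodule rG (I *m f).
  apply/mxmoduleP => g Gg; apply/row_subP => i.
  rewrite !row_mul fE -mulmxA -gring_mxJ // -fE submxMr //.
  exact: (mxmodule_trans mI Gg (row_sub i I)).
have sVW : (U + I *m f <= W)%MS.
  rewrite addsmx_sub (ltmxW ltUW) /=; apply/row_subP => i; rewrite row_mul fE.
  by apply: mxmodule_envelop mW _ vW; apply: gring_mxP.
have ltUV : (U < U + I *m f)%MS.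
  rewrite ltmxE addsmxSl /= addsmx_sub submx_refl /=; apply/negP => sIfU.
  move: ltKI; rewrite ltmxE => /andP[_ /negP]; apply; apply/row_subP => i.
  by rewrite KvP -fE -row_mul (submx_trans (row_sub _ _)).
have sWV : (W <= U + I *m f)%MS.
  apply: contrapT => /negP nWV; apply: (maxU (U + I *m f)%MS); split=> //.
    exact: addsmx_module.
  by rewrite ltmxE sVW.
have /sub_addsmxP[[a b] /= Ev] : (v <= U + I *m f)%MS := submx_trans vW sWV.
have eI : (e <= I)%MS.
  have: (e - b *m I <= I)%MS.
    apply: submx_trans (ltmxW ltKI); rewrite KvP -fE mulmxBl fe Ev mulmxA addrK.
    exact: submxMl.
  by move=> h; rewrite -[e](subrK (b *m I)) addmx_sub // submxMl.
move: ltI1; rewrite ltmxE => /andP[_ /negP]; apply; apply/row_subP => i.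
set z := row i _; rewrite -(gring_mxK z).
rewrite -[gring_mx _ z]mul1mx gring_row_mul.
by apply: mxmodule_envelop mI _ eI; apply: gring_mxP.
Qed.

Lemma rad_act_lt (W : 'M[K]_n) :
  mxmodule rG W -> W != 0 -> (act_mx rG W (rad KG) < W)%MS.
Proof.
move=> mW /max_submod_exists[U [mU maxU]].
exact: sub_ltmx_trans (rad_act_max mW mU maxU) maxU.1.
Qed.

End Nilpotency.

Lemma rad_pow_module k : mxmodule KG (rad_pow k).
Proof. by case: k => [|k]; [exact: mxmodule1 | exact/act_mx_module/rad_module]. Qed.

Lemma rad_pow_nilpotent n (rG : mx_representation K G n) :
  exists k, act_mx rG 1%:M (rad_pow k) == 0.
Proof.
pose W k := act_mx rG 1%:M (rad_pow k).
have mW k : mxmodule rG (W k) by apply/act_mx_module/rad_pow_module.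
have sW k : (W k.+1 <= act_mx rG (W k) (rad KG))%MS.
  apply/act_mx_subP => u x u1 xJ.
  pose f := lin1_mx (mulmx u \o gring_mx rG).
  have fE y : y *m f = u *m gring_mx rG y by rewrite mul_rV_lin1.
  rewrite -fE; apply: submx_trans (submxMr f xJ) _.
  rewrite /= /act_mx sumsmxMr_gen; apply/sumsmx_subP => i _.
  rewrite genmxE; apply/row_subP => j.
  rewrite !row_mul fE gring_mxA mulmxA.
  by apply: mem_act_mx (row_sub i _); apply: mem_act_mx (row_sub j _).
suff rk k : (W k == 0) || (\rank (W k) + k <= n)%N.
  exists n.+1; have /orP[//|] := rk n.+1.
  by rewrite addnS ltnNge leq_addl.
elim: k => [|k IHk]; first by rewrite addn0 rank_leq_row orbT.
have [Wk0 | nzWk] := eqVneq (W k) 0.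
  apply/orP; left; rewrite -submx0 -Wk0.
  exact: submx_trans (sW k) (act_mx_sub _ (mW k)).
rewrite (negPf nzWk) /= in IHk.
have ltW := sub_ltmx_trans (sW k) (rad_act_lt (mW k) nzWk).
by rewrite addnS (leq_trans _ IHk) ?orbT // ltn_add2r rank_ltmx.
Qed.

(* min {k | rad^k(KG) M = 0} *)
Definition loewy_length n (rG : mx_representation K G n) : nat :=
  ex_minn (rad_pow_nilpotent rG).

(* A is isomorphic to a quotient (by V) of a submodule U of M. *)
Definition subquotient m (M : mx_representation K G m)
    a (A : mx_representation K G a) : Prop :=
  exists (U : 'M[K]_m) (modU : mxmodule M U)
         (V : 'M[K]_(\rank U)) (modV : mxmodule (submod_repr modU) V),
    mx_rsim A (factmod_repr modV).

End Modules.

(* The maximum of S, with the maximum of the empty set read as 0. *)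
Definition is_max_or0 (S : nat -> Prop) (m : nat) : Prop :=
  (forall l, S l -> (l <= m)%N) /\ (S m \/ (m = 0%N /\ forall l, ~ S l)).

(* Main.v *)
(* Let l be the Loewy length of M tensor N and pick x in rad^(l-1)(KG) acting
   nontrivially on M tensor N.  Among the subquotients A of M such that x acts
   nontrivially on A tensor N, take one of least dimension.  If A were the sum
   of two proper submodules, or had two nonzero submodules with zero
   intersection, then A tensor N would be a quotient, resp. a submodule, of the
   direct sum of the modules obtained from the two smaller subquotients, and x
   would act nontrivially on one of these.  So A has a unique maximal and a
   unique minimal submodule, i.e. simple top and simple socle.  The same
   argument applied to A tensor N in the second factor then replaces N. *)
Require Import Defs.
From mathcomp Require Import all_boot all_algebra all_fingroup.
From mathcomp Require Import mxrepresentation character.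
From mathcomp Require Import boolp.

Set Implicit Arguments.
Unset Strict Implicit.
Unset Printing Implicit Defensive.

Import GroupScope GRing.Theory.
Local Open Scope ring_scope.

(** * Kronecker products: additivity, injectivity and surjectivity *)

Section TensorProductOfMatrices.
Variable K : fieldType.

Lemma tprodDl m1 n1 m2 n2 (A A' : 'M[K]_(m1, n1)) (B : 'M[K]_(m2, n2)) :
  tprod (A + A') B = tprod A B + tprod A' B.
Proof.
elim: m1 A A' => [|m1 IHm] A A' /=; first by rewrite addr0.
rewrite add_col_mx -IHm; congr col_mx; last by rewrite linearD.
by rewrite -!trowbE -linearD; congr trowb; rewrite linearD.
Qed.

Lemma tprodDr m1 n1 m2 n2 (A : 'M[K]_(m1, n1)) (B B' : 'M[K]_(m2, n2)) :
  tprod A (B + B') = tprod A B + tprod A B'.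
Proof.
elim: m1 A => [|m1 IHm] A /=; first by rewrite addr0.
by rewrite add_col_mx IHm linearD.
Qed.

Lemma row_free_tprod m1 n1 m2 n2 (A : 'M[K]_(m1, n1)) (B : 'M[K]_(m2, n2)) :
  row_free A -> row_free B -> row_free (tprod A B).
Proof.
move=> /row_freeP[A' AA'] /row_freeP[B' BB']; apply/row_freeP.
by exists (tprod A' B'); rewrite -tprodE AA' BB' tprod1.
Qed.

Lemma row_full_tprod m1 n1 m2 n2 (A : 'M[K]_(m1, n1)) (B : 'M[K]_(m2, n2)) :
  row_full A -> row_full B -> row_full (tprod A B).
Proof.
move=> /row_fullP[A' AA'] /row_fullP[B' BB']; apply/row_fullP.
by exists (tprod A' B'); rewrite -tprodE AA' BB' tprod1.
Qed.

End TensorProductOfMatrices.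

Section Modules.
Variables (K : fieldType) (gT : finGroupType) (G : {group gT}).
Local Notation repr := (mx_representation K G).

(** * Module homomorphisms as matrices, and the action of KG *)

Definition intertwines a b (A : repr a) (B : repr b) (f : 'M[K]_(a, b)) :=
  forall g, g \in G -> A g *m f = f *m B g.

Lemma intertwines1 a (A : repr a) : intertwines A A 1%:M.
Proof. by move=> g _; rewrite mulmx1 mul1mx. Qed.

Lemma intertwines_tprod a b c d (A : repr a) (B : repr b) (C : repr c)
    (D : repr d) f h :
  intertwines A B f -> intertwines C D h ->
  intertwines (prod_repr A C) (prod_repr B D) (tprod f h).
Proof. by move=> fh hh g Gg; rewrite /= -!tprodE fh ?hh. Qed.

Lemma intertwines_gring a b (A : repr a) (B : repr b) f x :
  intertwines A B f -> gring_mx A x *m f = f *m gring_mx B x.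
Proof.
move=> fh; rewrite /gring_mx /= ![x *m _]mulmx_sum_row !linear_sum.
rewrite mulmx_suml; apply: eq_bigr => i _.
by rewrite !linearZ /= -scalemxAl !rowK !mxvecK fh ?enum_valP.
Qed.

Lemma gring_mx_sub0 a b (A : repr a) (B : repr b) f x :
  intertwines A B f -> row_free f -> gring_mx B x = 0 -> gring_mx A x = 0.
Proof.
move=> fh ff Bx; apply: (row_free_inj ff).
by rewrite (intertwines_gring _ fh) Bx mulmx0 mul0mx.
Qed.

Lemma gring_mx_quo0 a b (A : repr a) (B : repr b) f x :
  intertwines A B f -> row_full f -> gring_mx A x = 0 -> gring_mx B x = 0.
Proof.
move=> fh ff Ax; apply: (row_full_inj ff).
by rewrite -(intertwines_gring _ fh) Ax mulmx0 mul0mx.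
Qed.

(** * Submodules, quotients and subquotients through explicit maps *)

Lemma submod_maps a (A : repr a) (U : 'M[K]_a) (mU : mxmodule A U) :
  exists i r,
    [/\ intertwines (submod_repr mU) A i, i *m r = 1%:M, (i <= U)%MS
      & forall m (W : 'M_(m, a)), (W <= U)%MS -> W *m r *m i = W].
Proof.
exists (val_submod 1%:M), (in_submod U 1%:M); split.
- by move=> g Gg; rewrite -val_submodE -val_submodJ // mul1mx.
- by rewrite -in_submodE val_submodK.
- exact: val_submodP.
by move=> m W sWU; rewrite -in_submodE -val_submodE in_submodK.
Qed.

Lemma factmod_maps a (A : repr a) (U : 'M[K]_a) (mU : mxmodule A U) :
  exists p s,
    [/\ intertwines A (factmod_repr mU) p, s *m p = 1%:M
      & forall m (W : 'M_(m, a)), (W *m p == 0) = (W <= U)%MS].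
Proof.
exists (in_factmod U 1%:M), (val_factmod 1%:M); split.
- by move=> g Gg; rewrite -in_factmodE -in_factmodJ // mul1mx.
- by rewrite -in_factmodE val_factmodK.
by move=> m W; rewrite -in_factmodE in_factmod_eq0.
Qed.

(** First isomorphism theorem: a linear section [s] of the projection [p], followed by [q], is the
    induced isomorphism, because [q] vanishes on the kernel of [p]. *)
Lemma factmod_kermx_rsim a b (A : repr a) (B : repr b) q
    (mV : mxmodule A (kermx q)) :
  intertwines A B q -> row_full q -> mx_rsim B (factmod_repr mV).
Proof.
move=> hq fq; apply: mx_rsim_sym.
have [p [s [hp sp kp]]] := factmod_maps mV.
have psq k (W : 'M_(k, a)) : W *m p *m s *m q = W *m q.
  apply/eqP; rewrite -subr_eq0 -mulmxBl; apply/eqP/sub_kermxP.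
  by rewrite -kp mulmxBl -(mulmxA (W *m p)) sp mulmx1 subrr.
exists (s *m q).
- by rewrite mxrank_coker mxrank_ker (eqP fq) subKn // -(eqP fq) rank_leq_row.
- rewrite -kermx_eq0 -submx0; apply/rV_subP => v /sub_kermxP.
  by rewrite mulmxA => /sub_kermxP; rewrite -kp -mulmxA sp mulmx1 submx0.
move=> g Gg; rewrite -[factmod_repr mV g]mul1mx -sp.
rewrite -(mulmxA s p) -hp // mulmxA (mulmxA s (A g)) psq -mulmxA hq //.
by rewrite mulmxA.
Qed.

Lemma subquotient_maps m (M : repr m) a (A : repr a) :
  subquotient M A ->
  exists (U : 'M[K]_m) d (D : repr d) i r p,
    [/\ mxmodule M U,
        [/\ intertwines D M i, i *m r = 1%:M, (i <= U)%MS
          & forall k (W : 'M_(k, m)), (W <= U)%MS -> W *m r *m i = W],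
        intertwines D A p & row_full p].
Proof.
case=> U [mU [V [mV /mx_rsim_sym[B eq_a fB hB]]]].
have [i [r iP]] := submod_maps mU.
have [p [s [hp sp _]]] := factmod_maps mV.
have /row_fullP[B' BB'] : row_full B by rewrite /row_full (eqP fB) eq_a.
exists U, (\rank U), (submod_repr mU), i, r, (p *m B); split=> // [g Gg|].
  by rewrite (mulmxA (submod_repr mU g)) hp // -(mulmxA p _ B) hB // mulmxA.
by apply/row_fullP; exists (B' *m s); rewrite mulmxA -(mulmxA B') sp mulmx1.
Qed.

(* A quotient map on a submodule U of M is encoded by a linear map p on all of
   M, of which only the restriction to U matters. *)
Lemma subquotientP m (M : repr m) a (A : repr a) :
  subquotient M A <->
  exists (U : 'M[K]_m) (p : 'M[K]_(m, a)),
    [/\ mxmodule M U, row_full (U *m p)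
      & forall g, g \in G -> U *m M g *m p = U *m p *m A g].
Proof.
split=> [/subquotient_maps | [U [p [mU fp hp]]]].
  case=> U [d [D [i [r [p [mU [hi ir siU ri] hp /row_fullP[q qp]]]]]]].
  have /submxP[w iw] := siU.
  (* The linear retraction [r] extends the quotient map from [U] to all of M; equivariance is only
     claimed on [U]. *)
  exists U, (r *m p); split=> // [|g Gg].
    apply/row_fullP; exists (q *m w); rewrite -!mulmxA.
    by rewrite (mulmxA w) -iw (mulmxA i) ir mul1mx.
  have -> : U *m M g = U *m r *m D g *m i.
    by rewrite -(mulmxA (U *m r)) hi // mulmxA ri.
  by rewrite -!mulmxA (mulmxA i) ir mul1mx hp.
have [i [r [hi ir /submxP[w iw] ri]]] := submod_maps mU.
have hq : intertwines (submod_repr mU) A (i *m p).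
  move=> g Gg; rewrite mulmxA hi // iw -!mulmxA; congr (_ *m _).
  by rewrite !mulmxA hp.
have fq : row_full (i *m p).
  have /row_fullP[q qp] := fp; apply/row_fullP; exists (q *m U *m r).
  by rewrite -(mulmxA q) mulmxA -(mulmxA q) ri // -mulmxA.
have mV : mxmodule (submod_repr mU) (kermx (i *m p)).
  apply/mxmoduleP => g Gg; apply/sub_kermxP.
  by rewrite -mulmxA hq // mulmxA mulmx_ker mul0mx.
exists U, mU, (kermx (i *m p)), mV; exact: factmod_kermx_rsim.
Qed.

Lemma subquotient_refl m (M : repr m) : subquotient M M.
Proof.
apply/subquotientP; exists 1%:M, 1%:M; split=> [||g _].
- exact: mxmodule1.
- by rewrite mulmx1 row_full_unit unitmx1.
by rewrite !mulmx1 !mul1mx.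
Qed.

Lemma subquotient_submod m (M : repr m) a (A : repr a) (W : 'M_a)
    (mW : mxmodule A W) :
  subquotient M A -> subquotient M (submod_repr mW).
Proof.
move=> /subquotientP[U [p [mU fp hp]]]; apply/subquotientP.
have [i [r [hi ir siW ri]]] := submod_maps mW.
(* [U1] is the preimage of [W] in [U]; following [p] by [r] maps it onto the submodule. *)
pose U1 := (U :&: kermx (p *m cokermx W))%MS.
have U1P k (v : 'M_(k, m)) : (v <= U1)%MS = (v <= U)%MS && (v *m p <= W)%MS.
  by rewrite sub_capmx sub_kermx mulmxA -submxE.
have hpU k (v : 'M_(k, m)) g : (v <= U)%MS -> g \in G ->
    v *m M g *m p = v *m p *m A g.
  case/submxP=> w -> Gg; rewrite -!mulmxA; congr (_ *m _).
  by rewrite !mulmxA hp.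
have /andP[sU1 sU1p] : (U1 <= U)%MS && (U1 *m p <= W)%MS by rewrite -U1P.
exists U1, (p *m r); split=> [||g Gg].
- apply/mxmoduleP => g Gg; rewrite U1P hpU // (mxmodule_trans mU) //.
  by rewrite (mxmodule_trans mW).
- have /row_fullP[q qp] := fp; rewrite mulmxA in qp.
  have : (i *m q *m U <= U1)%MS.
    rewrite U1P submxMl /= -mulmxA -(mulmxA i) mulmxA -(mulmxA i) (mulmxA q).
    by rewrite qp mulmx1.
  case/submxP=> w hw; apply/row_fullP; exists w.
  by rewrite mulmxA -hw -!mulmxA (mulmxA U) (mulmxA q) (mulmxA q) qp mul1mx.
rewrite !(mulmxA _ p r) hpU // -{1}(ri _ _ sU1p) -(mulmxA _ i (A g)) -hi //.
by rewrite (mulmxA _ _ i) -(mulmxA _ i r) ir mulmx1.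
Qed.

Lemma subquotient_factmod m (M : repr m) a (A : repr a) (W : 'M_a)
    (mW : mxmodule A W) :
  subquotient M A -> subquotient M (factmod_repr mW).
Proof.
move=> /subquotientP[U [p [mU /row_fullP[q qp] hp]]]; apply/subquotientP.
have [f [s [hf sf _]]] := factmod_maps mW.
exists U, (p *m f); split=> // [|g Gg].
  apply/row_fullP; exists (s *m q).
  by rewrite (mulmxA U) -(mulmxA s) (mulmxA q) qp mul1mx.
by rewrite !(mulmxA _ p f) hp // -(mulmxA _ f) -hf // mulmxA.
Qed.

(** Over a field, tensoring preserves injections and surjections, so A tensor B is a quotient of a
    module embedded in M tensor N, and annihilation by [x] is inherited. *)
Lemma subquotient_prod_gring0 m n (M : repr m) (N : repr n) a b
    (A : repr a) (B : repr b) x :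
  subquotient M A -> subquotient N B ->
  gring_mx (prod_repr M N) x = 0 -> gring_mx (prod_repr A B) x = 0.
Proof.
move=> /subquotient_maps[U [c [C [i [r [p [_ [hi ir _ _] hp fp]]]]]]].
move=> /subquotient_maps[V [d [D [j [t [q [_ [hj jt _ _] hq fq]]]]]]].
move=> MNx; apply: (gring_mx_quo0 (intertwines_tprod hp hq)).
  exact: row_full_tprod.
apply: (gring_mx_sub0 (intertwines_tprod hi hj)) => //.
by apply: row_free_tprod; apply/row_freeP; [exists r | exists t].
Qed.

(** * Loewy length as annihilation by powers of the radical *)

Lemma loewy_length_leP n (rG : repr n) k :
  reflect (forall x : 'rV_#|G|, (x <= rad_pow K G k)%MS -> gring_mx rG x = 0)
          (loewy_length rG <= k)%N.
Proof.
have actP j : act_mx rG 1%:M (rad_pow K G j) == 0 <->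
    forall x : 'rV_#|G|, (x <= rad_pow K G j)%MS -> gring_mx rG x = 0.
  rewrite -submx0 act_mx_subP; split=> h x.
    move=> xJ; apply/eqP; rewrite -submx0; apply/row_subP => i.
    by rewrite rowE h // submx1.
  by move=> u uI xJ; rewrite h // mulmx0 sub0mx.
(* Each power is a right ideal, so multiplying it by the radical can only shrink it. *)
have mono i j : (i <= j)%N -> (rad_pow K G j <= rad_pow K G i)%MS.
  move=> /subnK <-; elim: (j - i)%N => [|d IHd]; first exact: submx_refl.
  by apply: submx_trans IHd; apply/act_mx_sub/rad_pow_module.
rewrite /loewy_length; case: ex_minnP => l /actP hl minl.
apply: (iffP idP) => [le_lk x xJ | h]; first by apply/hl/(submx_trans xJ)/mono.
exact/minl/actP.
Qed.

(** * Criteria for simple top and simple socle *)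

Lemma irreducible_factmod a (A : repr a) (U : 'M_a) (mU : mxmodule A U) :
  maximal_submodule A U -> mx_irreducible (factmod_repr mU).
Proof.
case=> _ [ltU1 maxU]; apply/mx_irrP; split=> [|V mV nzV].
  by rewrite mxrank_coker subn_gt0 -[X in (_ < X)%N](mxrank1 K a) rank_ltmx.
pose W := (U + val_factmod V)%MS.
have mW : mxmodule A W by rewrite (val_factmod_module mU).
have ltUW : (U < W)%MS.
  rewrite ltmxE addsmxSl addsmx_sub submx_refl /=; apply: contra nzV => sVU.
  by rewrite -[V]val_factmodK in_factmod_eq0.
have fW : (1%:M <= W)%MS.
  apply: contrapT => /negP nfW; apply: (maxU W).
  by split; rewrite // ltmxE submx1.
have : (in_factmod U 1%:M <= in_factmod U W)%MS by apply: submxMr.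
rewrite in_factmod_addsK val_factmodK -sub1mx; apply: submx_trans.
apply/submxP; exists (val_factmod 1%:M).
by rewrite -in_factmodE val_factmodK.
Qed.

(** Two distinct maximal submodules would add up to the whole module although both are proper; so
    there is only one, and it is the radical. *)
Lemma simple_top_of_indecomposable_sum a (A : repr a) :
  (1%:M : 'M[K]_a) != 0 ->
  (forall U1 U2 : 'M_a, mxmodule A U1 -> mxmodule A U2 ->
     (1%:M <= U1 + U2)%MS -> row_full U1 \/ row_full U2) ->
  simple_top A.
Proof.
move=> nzA indecA; have [U [mU maxU]] := max_submod_exists A nzA.
have proper W : max_submod A W 1%:M -> ~ row_full W.
  by case; rewrite ltmxE submx1 sub1mx => /negP.
have maxE W : maximal_submodule A W -> (W :=: U)%MS.
  move=> [mW maxW].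
  have sub X Y : mxmodule A X -> mxmodule A Y -> max_submod A X 1%:M ->
      max_submod A Y 1%:M -> (X <= Y)%MS.
    move=> mX mY maxX maxY; apply: contrapT => /negP nXY.
    apply: (maxY.2 (X + Y)%MS); split; first exact: addsmx_module.
      by rewrite ltmxE addsmxSr addsmx_sub (negPf nXY).
    rewrite ltmxE submx1; apply/negP => sXY.
    by case: (indecA X Y mX mY sXY); apply: proper.
  by apply/eqmxP; rewrite !sub.
have radU : (Defs.rad A :=: U)%MS.
  apply/eqmxP/andP; split; apply/rV_subP => v vU.
    by apply: (bigcap_mxP _ _).1 vU _ _; split.
  by apply/bigcap_mxP => W /maxE ->.
apply: irreducible_factmod; split; first exact: rad_module.
exact: max_submod_eqmx (eqmx_sym radU) (eqmx_refl _) maxU.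
Qed.

(** Every simple submodule meets a fixed simple [S] nontrivially, hence lies in [S]; the socle, a
    sum of simple submodules, is therefore [S]. *)
Lemma simple_socle_of_indecomposable_cap a (A : repr a) :
  (1%:M : 'M[K]_a) != 0 ->
  (forall V1 V2 : 'M_a, mxmodule A V1 -> mxmodule A V2 -> (V1 :&: V2)%MS = 0 ->
     V1 = 0 \/ V2 = 0) ->
  simple_socle A.
Proof.
move=> nzA indecA.
have [S simS] : exists S, mxsimple A S.
  apply/asboolP; apply: (mxsimple_exists (mxmodule1 A) nzA) => [[S simS _]].
  by apply/asboolP; exists S.
have [mS nzS minS] := simS.
suff socS : (S :=: soc A)%MS by apply: mx_iso_simple (eqmx_iso A socS) simS.
apply/eqmxP; rewrite semisimple_sub_soc; last exact: mxsimple_semisimple.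
have [I T /= simT <- _] := soc_semisimple A; apply/sumsmx_subP => i _.
have [mT nzT minT] := simT i.
have nzI : (T i :&: S)%MS != 0.
  apply/eqP => /indecA[] // E; first by rewrite E eqxx in nzT.
  by rewrite E eqxx in nzS.
apply: submx_trans (capmxSr (T i) S).
by apply: minT nzI; rewrite ?capmxSl ?capmx_module.
Qed.

(* If T holds of a subquotient of M, it holds of one with simple top and simple
   socle: by stability under sums and subdirect products, any subquotient of
   least dimension satisfying T works. *)
Lemma subquotient_simple_top_socle m (M : repr m)
    (T : forall a, repr a -> Prop) :
  (forall (A : repr 0), ~ T _ A) ->
  (forall a1 a2 a (A1 : repr a1) (A2 : repr a2) (A : repr a) i1 i2 c1 c2,
     intertwines A1 A i1 -> intertwines A2 A i2 ->
     c1 *m i1 + c2 *m i2 = 1%:M -> T _ A -> T _ A1 \/ T _ A2) ->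
  (forall a1 a2 a (A1 : repr a1) (A2 : repr a2) (A : repr a) p1 p2 c1 c2,
     intertwines A A1 p1 -> intertwines A A2 p2 ->
     p1 *m c1 + p2 *m c2 = 1%:M -> T _ A -> T _ A1 \/ T _ A2) ->
  T _ M ->
  exists a (A : repr a),
    [/\ subquotient M A, T _ A, simple_top A & simple_socle A].
Proof.
move=> T0 Tsum Tcap TM.
have exT : exists a, `[< exists A : repr a, subquotient M A /\ T _ A >].
  by exists m; apply/asboolP; exists M; split=> //; apply: subquotient_refl.
case: (ex_minnP exT) => a /asboolP[A [sMA TA]] minA.
have {}minA b (B : repr b) : subquotient M B -> T _ B -> (a <= b)%N.
  by move=> sMB TB; apply: minA; apply/asboolP; exists B.
(* The zero module has neither simple top nor simple socle; [T0] excludes it. *)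
have nzA : (1%:M : 'M[K]_a) != 0.
  by rewrite -mxrank_eq0 mxrank1; case: (a) A TA {sMA minA} => // A /T0.
exists a, A; split=> //.
  apply: simple_top_of_indecomposable_sum => // U1 U2 mU1 mU2.
  move=> /sub_addsmxP[[u1 u2] /= E].
  have full U (mU : mxmodule A U) : T _ (submod_repr mU) -> row_full U.
    move/(minA _ _ (subquotient_submod mU sMA)) => le_a.
    by rewrite /row_full eqn_leq rank_leq_col.
  have [i1 [r1 [hi1 _ _ ri1]]] := submod_maps mU1.
  have [i2 [r2 [hi2 _ _ ri2]]] := submod_maps mU2.
  (* The coefficients in [E] give a linear section of the sum map from the direct sum of [U1] and
     [U2] onto A; it need not be equivariant. *)
  have [] :=
    Tsum _ _ _ _ _ A _ _ (u1 *m U1 *m r1) (u2 *m U2 *m r2) hi1 hi2 _ TA.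
  - by rewrite ri1 ?ri2 ?submxMl.
  - by move/full; left.
  by move/full; right.
apply: simple_socle_of_indecomposable_cap => // V1 V2 mV1 mV2 cap0.
have eq0 V (mV : mxmodule A V) : T _ (factmod_repr mV) -> V = 0.
  move/(minA _ _ (subquotient_factmod mV sMA)); rewrite mxrank_coker => le_a.
  apply/eqP; rewrite -mxrank_eq0 -leqn0 -(leq_add2r (a - \rank V)).
  by rewrite subnKC ?rank_leq_row.
have [p1 [s1 [hp1 _ kp1]]] := factmod_maps mV1.
have [p2 [s2 [hp2 _ kp2]]] := factmod_maps mV2.
(* Trivial intersection makes the map from A to the direct sum of A/V1 and A/V2 injective; the two
   halves of a linear one-sided inverse [c] are the coefficients for [Tcap]. *)
have /row_freeP[c Ec] : row_free (row_mx p1 p2).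
  rewrite -kermx_eq0 -submx0 -cap0; apply/rV_subP => v /sub_kermxP.
  by rewrite mul_mx_row => /eqP; rewrite row_mx_eq0 kp1 kp2 sub_capmx.
have [] := Tcap _ _ _ _ _ A _ _ (usubmx c) (dsubmx c) hp1 hp2 _ TA.
- by rewrite -mul_row_col vsubmxK.
- by move/eq0; left.
by move/eq0; right.
Qed.

(** * Reduction of both tensor factors *)

Lemma gring_mx_prod_subquotient m n (M : repr m) (N : repr n) x :
  gring_mx (prod_repr M N) x <> 0 ->
  exists a b (A : repr a) (B : repr b),
    [/\ subquotient M A /\ subquotient N B,
        simple_top A /\ simple_socle A,
        simple_top B /\ simple_socle B
      & gring_mx (prod_repr A B) x <> 0].
Proof.
(* Moving [x] past the equivariant [i1] and [i2] expresses its action on A through those on A1 and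
   A2, whatever the linear maps [c1] and [c2] are. *)
have sum0 a1 a2 a (A1 : repr a1) (A2 : repr a2) (A : repr a) i1 i2 c1 c2 :
    intertwines A1 A i1 -> intertwines A2 A i2 ->
    c1 *m i1 + c2 *m i2 = 1%:M -> gring_mx A x <> 0 ->
    gring_mx A1 x <> 0 \/ gring_mx A2 x <> 0.
  move=> h1 h2 E nz; apply/not_andP => -[Z1 Z2]; apply: nz.
  rewrite -[gring_mx A x]mul1mx -E mulmxDl -!mulmxA -(intertwines_gring _ h1).
  by rewrite -(intertwines_gring _ h2) Z1 Z2 !mul0mx !mulmx0 addr0.
have cap0 a1 a2 a (A1 : repr a1) (A2 : repr a2) (A : repr a) p1 p2 c1 c2 :
    intertwines A A1 p1 -> intertwines A A2 p2 ->
    p1 *m c1 + p2 *m c2 = 1%:M -> gring_mx A x <> 0 ->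
    gring_mx A1 x <> 0 \/ gring_mx A2 x <> 0.
  move=> h1 h2 E nz; apply/not_andP => -[Z1 Z2]; apply: nz.
  rewrite -[gring_mx A x]mulmx1 -E mulmxDr !mulmxA (intertwines_gring _ h1).
  by rewrite (intertwines_gring _ h2) Z1 Z2 !mulmx0 !mul0mx addr0.
move=> nzMN.
have [||||a [A [sMA nzA tA sA]]] := @subquotient_simple_top_socle m M
  (fun a A => gring_mx (prod_repr A N) x <> 0).
- by move=> A; case; apply: flatmx0.
- move=> a1 a2 a A1 A2 A i1 i2 c1 c2 h1 h2 E.
  apply: (sum0 _ _ _ _ _ _ (tprod i1 1%:M) (tprod i2 1%:M) (tprod c1 1%:M)
    (tprod c2 1%:M)); try exact/intertwines_tprod/intertwines1.
  by rewrite -!tprodE -tprodDl E mul1mx tprod1.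
- move=> a1 a2 a A1 A2 A i1 i2 c1 c2 h1 h2 E.
  apply: (cap0 _ _ _ _ _ _ (tprod i1 1%:M) (tprod i2 1%:M) (tprod c1 1%:M)
    (tprod c2 1%:M)); try exact/intertwines_tprod/intertwines1.
  by rewrite -!tprodE -tprodDl E mul1mx tprod1.
- exact: nzMN.
have [||||b [B [sNB nzB tB sB]]] := @subquotient_simple_top_socle n N
  (fun b B => gring_mx (prod_repr A B) x <> 0).
(* The dimension [a * 0] does not compute to 0, so the emptiness of the row index type is used. *)
- move=> B; case; apply/matrixP => i; suff: false by [].
  by case: i => i; rewrite muln0.
- move=> a1 a2 c A1 A2 C i1 i2 c1 c2 h1 h2 E.
  apply: (sum0 _ _ _ _ _ _ (tprod 1%:M i1) (tprod 1%:M i2) (tprod 1%:M c1)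
    (tprod 1%:M c2)); try exact: (intertwines_tprod (intertwines1 A)).
  by rewrite -!tprodE -tprodDr E mul1mx tprod1.
- move=> a1 a2 c A1 A2 C i1 i2 c1 c2 h1 h2 E.
  apply: (cap0 _ _ _ _ _ _ (tprod 1%:M i1) (tprod 1%:M i2) (tprod 1%:M c1)
    (tprod 1%:M c2)); try exact: (intertwines_tprod (intertwines1 A)).
  by rewrite -!tprodE -tprodDr E mul1mx tprod1.
- exact: nzA.
by exists a, b, A, B.
Qed.

End Modules.

Theorem proposition4 (K : fieldType) (gT : finGroupType) (G : {group gT})
    (m n : nat) (M : mx_representation K G m) (N : mx_representation K G n) :
  is_max_or0
    (fun l => exists (a b : nat)
        (A : mx_representation K G a) (B : mx_representation K G b),
      [/\ subquotient M A /\ subquotient N B,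
          simple_top A /\ simple_socle A,
          simple_top B /\ simple_socle B
        & l = loewy_length (prod_repr A B)])
    (loewy_length (prod_repr M N)).
Proof.
set S := fun l => _; have leS l : S l -> (l <= loewy_length (prod_repr M N))%N.
  case=> [a [b [A [B [[sMA sNB] _ _ ->]]]]]; apply/loewy_length_leP => x xJ.
  apply: (subquotient_prod_gring0 sMA sNB).
  by move: x xJ; apply/loewy_length_leP.
split=> //; have [SL | nSL] := pselect (S (loewy_length (prod_repr M N))).
  by left.
(* If the length is 0, any member of [S] is at most 0, hence equal to it, against [nSL]; so it
   remains to exclude a positive length. *)
right; suff L0 : loewy_length (prod_repr M N) = 0%N.
  by split=> // l Sl; apply: nSL; have := leS l Sl; rewrite L0 leqn0 => /eqP <-.
case EL: (loewy_length _) => [//|k]; case: nSL.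
(* For length k+1, some [x] in the k-th power of the radical still acts nontrivially. *)
have : ~~ (loewy_length (prod_repr M N) <= k)%N by rewrite EL ltnn.
move=> /loewy_length_leP /existsNP[x /not_implyP[xJ nzx]].
have [a [b [A [B [sAB tA tB nzAB]]]]] := gring_mx_prod_subquotient nzx.
have SAB : S (loewy_length (prod_repr A B)) by exists a, b, A, B.
(* As [x] acts nontrivially on A tensor B, its length exceeds k; by [leS] it is exactly k+1. *)
suff <- : loewy_length (prod_repr A B) = loewy_length (prod_repr M N) by [].
apply/eqP; rewrite eqn_leq leS //= EL ltnNge; apply/negP => /loewy_length_leP h.
exact/nzAB/h.
Qed.
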